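(* Let $A$ be a hemiimplicative semilattice and $a\in A$. Then $F^{c}(a)=T(\{a\})$.
   Context: A hemiimplicative semilattice is an algebra $(A,\wedge,\to,1)$ of type $(2,2,0)$ such that: $(A,\wedge,1)$ is a meet-semilattice with greatest element $1$ (ordered by $a\le b$ iff $a\wedge b=a$); $a\to a=1$ for every $a\in A$; and for all $a,b,c\in A$, if $a\le b\to c$ then $a\wedge b\le c$. Write $a\leftrightarrow b:=(a\to b)\wedge(b\to a)$ and $t(a,b,f):=(a\to b)\leftrightarrow((a\wedge f)\to(b\wedge f))$. A filter is a subset $F\subseteq A$ with $1\in F$, closed under $\wedge$, and upward closed. A filter $F$ is congruent if $t(a,b,f)\in F$ for every $a,b\in A$ and $f\in F$. $F^{c}(a)$ denotes the congruent filter generated by $\{a\}$, i.e. the smallest congruent filter containing $a$. For $X\subseteq A$ and $x,y\in A$, $t^{+}(x,y,X)$ is the set of all $z\in A$ such that $z\ge t(x,y,w_1)\wedge\dots\wedge t(x,y,w_k)\wedge w_{k+1}\wedge\dots\wedge w_{k+l}$ for some $k,l\geq 0$ and some $w_1,\dots,w_{k+l}\in X$ with $k+l\ge 1$. Put $t(X):=\bigcup_{x,y\in A}t^{+}(x,y,X)$, $T_0(X):=X$, $T_{n+1}(X):=t(T_n(X))$, and $T(X):=\bigcup_{n\in\mathbb{N}}T_n(X)$, where $\mathbb N$ includes $0$. *)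

(* Defs.v *)
From HB Require Import structures.
From mathcomp Require Import all_boot all_order.
From mathcomp Require Import boolp classical_sets.

Set Implicit Arguments.
Unset Strict Implicit.
Unset Printing Implicit Defensive.

Local Open Scope order_scope.

(* The order of the library satisfies (a <= b) = (a `&` b == a) (Order.leEmeet);
   the constant 1 is \top. Since classical logic and choice are available from
   boolp, the choiceType structure underlying an ordered type is no restriction
   on the carrier. *)
#[key="T"]
HB.mixin Record isHemiImplicative (d : Order.disp_t) T
    of Order.TMeetSemilattice d T := {
  himp : T -> T -> T;
  himpxx : forall a : T, himp a a = \top;
  himp_le : forall a b c : T, a <= himp b c -> a `&` b <= c
}.

#[short(type="hemiImplSemilatticeType")]
HB.structure Definition HemiImplSemilattice (d : Order.disp_t) :=
  { T of Order.TMeetSemilattice d T & isHemiImplicative d T }.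

Section HemiImplicative.
Variables (d : Order.disp_t) (A : hemiImplSemilatticeType d).
Implicit Types (a b f x y z : A) (F X : set A).

Definition hiff a b : A := himp a b `&` himp b a.

Definition tterm a b f : A := hiff (himp a b) (himp (a `&` f) (b `&` f)).

Definition is_filter F : Prop :=
  [/\ F \top,
      (forall x y, F x -> F y -> F (x `&` y))
    & (forall x y, x <= y -> F x -> F y)].

Definition is_congruent F : Prop :=
  forall a b f, F f -> F (tterm a b f).

Definition congruent_filter F : Prop := is_filter F /\ is_congruent F.

Definition congruent_filter_gen a : set A := smallest congruent_filter [set a]%classic.

(* [smallest] is an intersection; it is itself a congruent filter. *)
Lemma congruent_filter_genP a : congruent_filter (congruent_filter_gen a).
Proof.
split; first split.
- by move=> F [[[]]].
- move=> x y Fx Fy F FP; case: (FP) => [[[_ FI _] _] _].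
  by apply: FI; [exact: Fx | exact: Fy].
- move=> x y xy Fx F FP; case: (FP) => [[[_ _ FU] _] _].
  by apply: FU xy _; exact: Fx.
- move=> x y f Ff F FP; case: (FP) => [[_ FC] _].
  by apply: FC; exact: Ff.
Qed.

(* The family w is split by lshift/rshift into its first k and last l members;
   an empty meet is \top. *)
Definition tplus x y X : set A :=
  [set z | exists (k l : nat) (w : 'I_(k + l) -> A),
     [/\ (1 <= k + l)%N,
         (forall i, X (w i))
       & ((\meet_(i < k) tterm x y (w (lshift l i)))
            `&` (\meet_(j < l) w (rshift k j)) <= z)%O]]%classic.

Definition tset X : set A :=
  (\bigcup_(x in [set: A]) \bigcup_(y in [set: A]) tplus x y X)%classic.

Definition Tn (n : nat) X : set A := iter n tset X.

Definition Tclosure X : set A := (\bigcup_(n in [set: nat]) Tn n X)%classic.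

End HemiImplicative.

(* Main.v *)
Require Import Defs.
From mathcomp Require Import all_boot all_order.
From mathcomp Require Import boolp classical_sets.

Set Implicit Arguments.
Unset Strict Implicit.
Unset Printing Implicit Defensive.

Import Order.Theory.

(** One application of t to X adjoins the terms t(x, y, w), the binary meets and the upper bounds of
    elements of X, so the stages [Tn] increase. Any two elements of T(X) thus share a stage, and the
    next stage has what the closure axioms demand: [Tclosure_congruent_filter]. Conversely, a
    congruent filter containing X is stable under t, hence contains every stage:
    [congruent_filter_Tclosure]. *)

Lemma tset_tterm (d : Order.disp_t) (A : hemiImplSemilatticeType d)
  (X : set A) (x y w : A) : X w -> tset X (tterm x y w).
Proof.
move=> Xw; exists x => //; exists y => //; exists 1, 0, (fun=> w); split => //.
by rewrite big_ord_recl !big_ord0 !meetx1.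
Qed.

Lemma tset_meet_le (d : Order.disp_t) (A : hemiImplSemilatticeType d)
  (X : set A) (u v z : A) :
  X u -> X v -> (Order.meet u v <= z)%O -> tset X z.
Proof.
(* With k = 0 no term t(x, y, w) occurs, so the top serves as an arbitrary choice of x and y. *)
move=> Xu Xv uvz; exists Order.top => //; exists Order.top => //.
exists 0, 2, (fun i => if i == ord0 then u else v); split => //.
  by move=> i; case: ifP.
by rewrite !big_ord_recl !big_ord0 meet1x meetx1.
Qed.

Lemma tset_le (d : Order.disp_t) (A : hemiImplSemilatticeType d)
  (X : set A) (u z : A) : X u -> (u <= z)%O -> tset X z.
Proof. by move=> Xu uz; apply: (tset_meet_le Xu Xu); rewrite meetxx. Qed.

(** Each element lies above itself, so by [tset_le] it survives one more application of t. *)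
Lemma Tn_homo (d : Order.disp_t) (A : hemiImplSemilatticeType d)
  (X : set A) (m n : nat) : m <= n -> (Tn m X `<=` Tn n X)%classic.
Proof.
move=> /subnK <-; elim: (n - m) => [//|k IHk] z /IHk Tz.
exact: tset_le Tz (lexx z).
Qed.

Lemma Tclosure_congruent_filter (d : Order.disp_t)
  (A : hemiImplSemilatticeType d) (X : set A) (a : A) :
  X a -> congruent_filter (Tclosure X).
Proof.
move=> Xa; split; first split.
(* Since k + l >= 1 excludes the empty meet, the top is reached at stage 1 as an upper bound of
   [a]. *)
- by exists 1 => //; apply: (tset_le Xa); exact: lex1.
- move=> x y [m _ Tx] [n _ Ty]; exists (maxn m n).+1 => //.
  apply: tset_meet_le (lexx _).
    exact: Tn_homo (leq_maxl m n) _ Tx.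
  exact: Tn_homo (leq_maxr m n) _ Ty.
- by move=> x y xy [n _ Tx]; exists n.+1 => //; exact: tset_le Tx xy.
- by move=> x y f [n _ Tf]; exists n.+1 => //; exact: tset_tterm.
Qed.

Lemma congruent_filter_tset (d : Order.disp_t)
  (A : hemiImplSemilatticeType d) (F X : set A) :
  congruent_filter F -> (X `<=` F)%classic -> (tset X `<=` F)%classic.
Proof.
move=> [[F1 FI FU] FC] XF z [x _ [y _ [k [l [w [_ Xw le_z]]]]]]; apply: FU le_z _.
(* Both finite meets stay in [F], an empty one being the top; congruence handles the factors t(x, y,
   w). *)
by apply: (FI); apply: big_ind => // i _; [apply: FC|]; exact: XF.
Qed.

Lemma congruent_filter_Tclosure (d : Order.disp_t)
  (A : hemiImplSemilatticeType d) (F X : set A) :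
  congruent_filter F -> (X `<=` F)%classic -> (Tclosure X `<=` F)%classic.
Proof.
move=> FP XF z [n _]; elim: n z => [|n IHn]; first exact: XF.
exact: congruent_filter_tset.
Qed.

Theorem proposition4p12 (d : Order.disp_t) (A : hemiImplSemilatticeType d)
  (a : A) : congruent_filter_gen a = Tclosure [set a]%classic.
Proof.
rewrite eqEsubset; split.
- apply: smallest_sub; first exact: (@Tclosure_congruent_filter _ _ _ a).
  by move=> z az; exists 0.
- apply: congruent_filter_Tclosure; first exact: congruent_filter_genP.
  exact: sub_smallest.
Qed.
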